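(* Let $f:\mathcal{X}\times\Theta\to\mathbb{R}$ be a compositional constraint function with $C\ge1$ components (as defined in the context), and let $\mathcal{F}=\{f_x\in\mathbb{R}^\Theta : f_x(\theta)=f(x,\theta),\ x\in\mathcal{X}\}$. Then $$\mathcal{R}_N(\mathcal{F})\le\sum_{k=1}^C\frac{\left(\prod_{j=k}^C\overline{\rho}_j\right)\overline{\varphi}_k\,\tau_k\,\Lambda_k}{\sqrt N},$$ where $\tau_k=\sup_{\theta\in\Theta}\|\psi_k(\theta)\|$, $\Lambda_k=\sup_{x\in\mathcal{X}}\|\phi_k(x)\|$, $\overline{\rho}_1=1$, and $\overline{\rho}_k$ (for $k\ge2$) and $\overline{\varphi}_k$ (for $k\ge1$) are the Lipschitz constants of the functions $\rho_k$ and $\varphi_k$, respectively.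
   Context: Compositional constraint function: for $k=1,\dots,C$ let $f_k(x,\theta)=\psi_k(\theta)^\top\phi_k(x)+\eta_k(\theta)$ with functions $\psi_k:\Theta\to\mathbb{R}^{n_k}$, $\phi_k:\mathcal{X}\to\mathbb{R}^{n_k}$, $\eta_k:\Theta\to\mathbb{R}$. Let $\varphi_k:\mathbb{R}\to\mathbb{R}$ ($k=1,\dots,C$) and $\rho_k:\mathbb{R}\to\mathbb{R}$ ($k=2,\dots,C$) be Lipschitz continuous, and for $k=2,\dots,C$ let $g_k$ be one of the binary operators $(a,b)\mapsto\max(a,b)$, $(a,b)\mapsto\min(a,b)$, $(a,b)\mapsto a+b$, $(a,b)\mapsto a-b$. Define $f^1(x,\theta)=\varphi_1(f_1(x,\theta))$ and, for $k\ge2$, $f^k(x,\theta)=\rho_k\big(g_k(f^{k-1}(x,\theta),\varphi_k(f_k(x,\theta)))\big)$; then $f=f^C$. No convexity is assumed on $\mathcal{X}$ or on any of these functions. $\|\cdot\|$ is the Euclidean norm. Rademacher complexity: let $\theta_1,\dots,\theta_N$ be independent copies of a random variable $\theta\in\Theta$ and $\sigma_1,\dots,\sigma_N$ independent random variables uniformly distributed in $\{-1,+1\}$ (independent of the sample). For a class $\mathcal{F}$ of real-valued functions on $\Theta$, $\hat{\mathcal{R}}_N(\mathcal{F})=\mathbb{E}_{\sigma}\left[\sup_{h\in\mathcal{F}}\frac1N\sum_{i=1}^N\sigma_i h(\theta_i)\,\middle|\,(\theta_i)_{1\le i\le N}\right]$ and $\mathcal{R}_N(\mathcal{F})=\mathbb{E}_{(\theta_i)}\hat{\mathcal{R}}_N(\mathcal{F})$.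 *)

(* Defs.v *)
From HB Require Import structures.
From mathcomp Require Import all_boot all_order all_algebra.
From mathcomp Require Import all_classical all_reals all_analysis.
Set Implicit Arguments.
Unset Strict Implicit.
Unset Printing Implicit Defensive.
Import Order.TTheory GRing.Theory Num.Theory.
Import numFieldNormedType.Exports.
Local Open Scope classical_set_scope.
Local Open Scope ring_scope.

(* The library norm on matrices is the sup norm, so the Euclidean norm is
   defined here. *)
Definition enorm (R : realType) (n : nat) (u : 'cV[R]_n) : R :=
  Num.sqrt (\sum_(i < n) u i 0 ^+ 2).

(* The least Lipschitz constant.  The infimum is over a nonempty set bounded
   below by 0 when f is Lipschitz, and is then attained. *)
Definition lip_const (R : realType) (f : R -> R) : R :=
  inf [set L : R | L.-lipschitz f].

Inductive binop := OpMax | OpMin | OpAdd | OpSub.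

Definition binop_fun (R : realType) (o : binop) (a b : R) : R :=
  match o with
  | OpMax => Num.max a b
  | OpMin => Num.min a b
  | OpAdd => a + b
  | OpSub => a - b
  end.

(* Families indexed by the components 1, ..., C are functions on nat; their
   values at 0 and above C are irrelevant. *)
Definition component (R : realType) (X Theta : Type) (n : nat -> nat)
    (psi : forall k, Theta -> 'cV[R]_(n k)) (phi : forall k, X -> 'cV[R]_(n k))
    (eta : nat -> Theta -> R) (k : nat) (x : X) (t : Theta) : R :=
  ((psi k t)^T *m phi k x) 0 0 + eta k t.

(* The value 0 at k = 0 is a dummy: rho 1 and g 1 are never used. *)
Fixpoint compose (R : realType) (X Theta : Type) (varphi rho : nat -> R -> R)
    (g : nat -> binop) (fc : nat -> X -> Theta -> R) (k : nat) (x : X)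
    (t : Theta) {struct k} : R :=
  match k with
  | 0%N => 0
  | 1%N => varphi 1%N (fc 1%N x t)
  | k'.+1 => rho k (binop_fun (g k) (compose varphi rho g fc k' x t)
                                    (varphi k (fc k x t)))
  end.

Definition rho_bar (R : realType) (rho : nat -> R -> R) (k : nat) : R :=
  if k == 1%N then 1 else lip_const (rho k).

Definition sup_enorm (R : realType) (T : Type) (n : nat) (u : T -> 'cV[R]_n)
    : \bar R :=
  ereal_sup [set (enorm (u t))%:E | t in [set: T]].

(* Mutual independence of a finite family of systems of events. *)
Definition mutually_independent (d : measure_display) (Omega : measurableType d)
    (R : realType) (P : probability Omega R) (I : finType)
    (F : I -> set (set Omega)) : Prop :=
  forall (J : {set I}) (A : I -> set Omega),
    (forall j, j \in J -> F j (A j)) ->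
    P (\bigcap_(j in [set` J]) A j) = (\prod_(j in J) P (A j))%E.

(* Uniform distribution on {-1, +1}. *)
Definition rademacher_rv (d : measure_display) (Omega : measurableType d)
    (R : realType) (P : probability Omega R) (s : {RV P >-> R}) : Prop :=
  P (s @^-1` [set 1]) = (2^-1)%:E /\ P (s @^-1` [set (-1)]) = (2^-1)%:E.

(* The thetas are copies of theta, the sigmas are Rademacher signs, and the
   2N variables thetas, sigmas are mutually independent. *)
Definition sample_and_signs (d d' : measure_display) (Omega : measurableType d)
    (Theta : measurableType d') (R : realType) (P : probability Omega R)
    (N : nat) (theta : {RV P >-> Theta}) (thetas : 'I_N -> {RV P >-> Theta})
    (sigma : 'I_N -> {RV P >-> R}) : Prop :=
  [/\ forall i, distribution P (thetas i) = distribution P theta,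
      forall i, rademacher_rv (sigma i)
    & mutually_independent P (fun j : 'I_N + 'I_N =>
        match j with
        | inl i => g_sigma_algebra_preimage (thetas i)
        | inr i => g_sigma_algebra_preimage (sigma i)
        end)].

(* Empirical Rademacher complexity at a sample t: the signs being independent of
   the sample, the conditional expectation given the sample is the expectation
   over the signs alone, with the sample frozen at t. *)
Definition emp_rademacher (d d' : measure_display) (Omega : measurableType d)
    (Theta : measurableType d') (R : realType) (P : probability Omega R)
    (N : nat) (sigma : 'I_N -> {RV P >-> R}) (F : set (Theta -> R))
    (t : 'I_N -> Theta) : \bar R :=
  (\int[P]_w ereal_sup
     [set ((N%:R)^-1 * \sum_(i < N) sigma i w * h (t i))%R%:E | h in F])%E.

Definition rademacher (d d' : measure_display) (Omega : measurableType d)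
    (Theta : measurableType d') (R : realType) (P : probability Omega R)
    (N : nat) (thetas : 'I_N -> {RV P >-> Theta})
    (sigma : 'I_N -> {RV P >-> R}) (F : set (Theta -> R)) : \bar R :=
  (\int[P]_w emp_rademacher sigma F (fun i => thetas i w))%E.

(* Main.v *)
(* For a frozen sample, the conditional expectation over the signs is the average
   over all sign patterns of the supremum over x of the signed sums.  Averages of
   this kind contract under coordinatewise Lipschitz maps (pair each pattern with
   the one differing at a single coordinate) and are subadditive under +, -, max
   and min, since max and min are (a + b)/2 plus or minus |a - b|/2.  Peeling the
   composition from the outside leaves the affine components, for which
   Cauchy-Schwarz and the orthogonality of the signs give tau Lambda / sqrt N.
   The bound does not depend on the sample, so the outer expectation is
   harmless. *)
Require Import Defs.
From HB Require Import structures.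
From mathcomp Require Import all_boot all_order all_algebra.
From mathcomp Require Import all_classical all_reals all_analysis.
From mathcomp Require Import measurable_realfun ring lra.
Import Order.TTheory GRing.Theory Num.Theory.
Import numFieldNormedType.Exports.
Local Open Scope classical_set_scope.
Local Open Scope ring_scope.

Set Implicit Arguments.
Unset Strict Implicit.

(** * Sign patterns, signed sums and the flip of one sign *)

Definition signed_sum (R : realType) (N : nat) (eps : {ffun 'I_N -> bool})
    (a : 'I_N -> R) : R :=
  \sum_(i < N) (-1) ^+ eps i * a i.

(* 2^N N times the empirical Rademacher complexity of the class whose member x
   takes the values A x i on the sample. *)
Definition rad_sum (R : realType) (X : Type) (N : nat) (A : X -> 'I_N -> R)
    : \bar R :=
  (\sum_(eps : {ffun 'I_N -> bool})
     ereal_sup [set (signed_sum eps (A x))%:E | x in [set: X]])%E.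

Definition flip (N : nat) (i0 : 'I_N) (eps : {ffun 'I_N -> bool}) :=
  [ffun i => if i == i0 then ~~ eps i else eps i].

Lemma flipK (N : nat) (i0 : 'I_N) : involutive (flip i0).
Proof.
by move=> e; apply/ffunP => i; rewrite !ffunE; case: eqP => // _; rewrite negbK.
Qed.

(** [true] encodes the sign -1, so each pair is represented by its member with sign -1 at [i0]. *)
Lemma sum_flip (V : nmodType) (N : nat) (i0 : 'I_N)
    (F : {ffun 'I_N -> bool} -> V) :
  \sum_(eps : {ffun _}) F eps =
  \sum_(eps : {ffun _} | eps i0) (F eps + F (flip i0 eps)).
Proof.
rewrite (bigID (fun e : {ffun _} => e i0)) /= big_split /=; congr (_ + _).
rewrite (reindex_inj (inv_inj (flipK i0))) /=.
by apply: eq_bigl => e; rewrite ffunE eqxx negbK.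
Qed.

Lemma signed_sum_flip (R : realType) (N : nat) (i0 : 'I_N)
    (eps : {ffun 'I_N -> bool}) (a : 'I_N -> R) :
  signed_sum (flip i0 eps) a = signed_sum eps a - 2 * (-1) ^+ eps i0 * a i0.
Proof.
rewrite /signed_sum (bigD1 i0) //= [in RHS](bigD1 i0) //= ffunE eqxx.
rewrite [X in _ + X](eq_bigr (fun i => (-1) ^+ eps i * a i)); last first.
  by move=> i /negbTE ii0; rewrite ffunE ii0.
by rewrite signrN; ring.
Qed.

Lemma signed_sumD (R : realType) (N : nat) (eps : {ffun 'I_N -> bool})
    (a b : 'I_N -> R) :
  signed_sum eps (fun i => a i + b i) = signed_sum eps a + signed_sum eps b.
Proof. by rewrite -big_split; apply: eq_bigr => i _; rewrite mulrDr. Qed.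

Lemma signed_sumZ (R : realType) (N : nat) (eps : {ffun 'I_N -> bool})
    (c : R) (a : 'I_N -> R) :
  signed_sum eps (fun i => c * a i) = c * signed_sum eps a.
Proof. by rewrite mulr_sumr; apply: eq_bigr => i _; rewrite mulrCA. Qed.

(** * Suprema, and contraction of sign averages *)

Lemma ereal_sup_fin_gtNy (R : realType) (X : Type) (x0 : X) (f : X -> R) :
  (-oo < ereal_sup [set (f x)%:E | x in [set: X]])%E.
Proof.
by apply: lt_le_trans (ltNyr (f x0)) _; apply: ereal_sup_ubound; exists x0.
Qed.

(** The two suprema run over independent points, so a bound on two paired sign patterns reduces to
    an inequality for an arbitrary pair of points. The suprema are removed one at a time by
    subtraction. *)
Lemma ereal_sup_add_le (R : realType) (X : Type) (f g : X -> R) (M : \bar R) :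
  (forall x y, (f x + g y)%:E <= M)%E ->
  (ereal_sup [set (f x)%:E | x in [set: X]] +
   ereal_sup [set (g x)%:E | x in [set: X]] <= M)%E.
Proof.
move=> H.
have Hg x : ((f x)%:E + ereal_sup [set (g x)%:E | x in [set: X]] <= M)%E.
  rewrite addeC -leeBrDr//; apply: ge_ereal_sup => _ [y _ <-].
  by rewrite leeBrDr// -EFinD addrC.
(* Subtracting the second supremum requires it to be finite. If it is [+oo], then [Hg] at any point
   forces [M] to be [+oo], and without points the first supremum is [-oo]. *)
case E : (ereal_sup [set (g x)%:E | x in [set: X]]) => [b| |]; last first.
- by rewrite addeNy leNye.
- have [x|noX] := pselect (inhabited X); last first.
    rewrite (_ : [set (f x)%:E | x in _] = set0) ?ereal_sup0 ?leNye//.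
    by apply/seteqP; split=> // y [x _ _]; case: noX.
  case: x => x; have := Hg x; rewrite E addey// leye_eq => /eqP ->.
  by rewrite leey.
rewrite -leeBrDr//; apply: ge_ereal_sup => _ [x _ <-].
by rewrite leeBrDr// -E.
Qed.

(** A pattern and its flip at [i0] share all terms except the one at [i0]. For points x and y the
    pair therefore sees coordinate [i0] only through a difference of values at x and y, and
    exchanging the two points changes the sign of that difference. The pair of suprema thus sees its
    absolute value. *)
Lemma rad_sum_le1 (R : realType) (X : Type) (N : nat) (i0 : 'I_N)
    (A B : X -> 'I_N -> R) :
  (forall x i, i != i0 -> A x i = B x i) ->
  (forall x y, `|A x i0 - A y i0| <= `|B x i0 - B y i0|) ->
  (rad_sum A <= rad_sum B)%E.
Proof.
move=> AB leAB; rewrite /rad_sum !(sum_flip i0); apply: lee_sum => e ei0.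
set S := ereal_sup [set (signed_sum e (B x))%:E | x in _].
set S' := ereal_sup [set (signed_sum (flip i0 e) (B x))%:E | x in _].
have ubS x : ((signed_sum e (B x))%:E <= S)%E by apply: ereal_sup_ubound; exists x.
have ubS' x : ((signed_sum (flip i0 e) (B x))%:E <= S')%E.
  by apply: ereal_sup_ubound; exists x.
have decomp (D : X -> 'I_N -> R) x : signed_sum e (D x) =
    \sum_(i < N | i != i0) (-1) ^+ e i * D x i - D x i0.
  by rewrite /signed_sum (bigD1 i0) //= ei0 expr1 mulN1r addrC.
have decA x : signed_sum e (A x) = signed_sum e (B x) + (B x i0 - A x i0).
  rewrite !decomp (eq_bigr (fun i => (-1) ^+ e i * B x i)); first by ring.
  by move=> i /AB ->.
apply: ereal_sup_add_le => x y; rewrite signed_sum_flip !decA ei0 expr1.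
(* The point with the larger [B]-value at [i0] goes to the flipped pattern, whose sign there is +1;
   the other goes to [e]. *)
have := leAB x y; case: (lerP 0 (B x i0 - B y i0)) => Bxy.
- rewrite (ger0_norm Bxy) ler_norml => /andP[h1 h2].
  apply: le_trans (leeD (ubS y) (ubS' x)); rewrite -EFinD lee_fin.
  by rewrite signed_sum_flip ei0 expr1; lra.
- rewrite (ltr0_norm Bxy) ler_norml => /andP[h1 h2].
  apply: le_trans (leeD (ubS x) (ubS' y)); rewrite -EFinD lee_fin.
  by rewrite signed_sum_flip ei0 expr1; lra.
Qed.

(* Ledoux-Talagrand contraction, replacing the coordinates one at a time. *)
Lemma rad_sum_le (R : realType) (X : Type) (N : nat) (A B : X -> 'I_N -> R) :
  (forall x y i, `|A x i - A y i| <= `|B x i - B y i|) ->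
  (rad_sum A <= rad_sum B)%E.
Proof.
move=> leAB; pose D m x (i : 'I_N) := if (i < m)%N then A x i else B x i.
have DB : D 0%N = B by [].
have DA : D N = A by apply/funext => x; apply/funext => i; rewrite /D ltn_ord.
suff leD m : (m <= N)%N -> (rad_sum (D m) <= rad_sum B)%E by rewrite -DA leD.
elim: m => [|m IHm] mN; first by rewrite DB.
apply: le_trans (IHm (ltnW mN)); apply: (@rad_sum_le1 _ _ _ (Ordinal mN)).
  move=> x i; rewrite -val_eqE /= => im.
  by rewrite /D ltnS leq_eqVlt (negbTE im).
by move=> x y; rewrite /D /= ltnSn ltnn.
Qed.

(** * Sign averages under sums, scaling, Lipschitz maps and binary operators *)

Lemma rad_sumD (R : realType) (X : Type) (N : nat) (A B : X -> 'I_N -> R) :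
  (rad_sum (fun x i => A x i + B x i)%R <= rad_sum A + rad_sum B)%E.
Proof.
rewrite -big_split /=; apply: lee_sum => e _; apply: ge_ereal_sup => _ [x _ <-].
by rewrite signed_sumD EFinD leeD//; apply: ereal_sup_ubound; exists x.
Qed.

Lemma rad_sumN (R : realType) (X : Type) (N : nat) (A : X -> 'I_N -> R) :
  (rad_sum (fun x i => - A x i)%R <= rad_sum A)%E.
Proof. by apply: rad_sum_le => x y i; rewrite -opprD normrN. Qed.

Lemma rad_sumZ (R : realType) (X : Type) (x0 : X) (N : nat) (c : R)
    (A : X -> 'I_N -> R) : 0 <= c ->
  (rad_sum (fun x i => c * A x i)%R <= c%:E * rad_sum A)%E.
Proof.
move=> c0; rewrite fin_num_sume_distrr//; last first.
  (* A point of [X] keeps every supremum above [-oo], so no sum mixes the two infinities and [c]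
     distributes. *)
  by move=> e e' _ _; apply: ltninfty_adde_def; rewrite inE; apply: ereal_sup_fin_gtNy.
apply: lee_sum => e _; apply: ge_ereal_sup => _ [x _ <-].
rewrite signed_sumZ EFinM lee_wpmul2l ?lee_fin//.
by apply: ereal_sup_ubound; exists x.
Qed.

(** Negating all signs at once turns the total into its opposite. This is what eliminates the
    offsets [eta k]. *)
Lemma rad_sum_cst (R : realType) (X : Type) (x0 : X) (N : nat) (a : 'I_N -> R) :
  rad_sum (fun _ : X => a) = 0%E.
Proof.
pose neg (e : {ffun 'I_N -> bool}) := [ffun i => ~~ e i].
have negK : involutive neg by move=> e; apply/ffunP => i; rewrite !ffunE negbK.
rewrite /rad_sum (eq_bigr (fun e => (signed_sum e a)%:E)) => [|e _]; last first.
  rewrite (_ : [set _ | _ in _] = [set (signed_sum e a)%:E]) ?ereal_sup1//.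
  by apply/seteqP; split=> [y [_ _ <-]|y ->]//; exists x0.
rewrite sumEFin; congr (_%:E); set s := (X in X = _).
suff : s = - s by lra.
rewrite /s -[in RHS]sumrN (reindex_inj (inv_inj negK)); apply: eq_bigr => e _.
by rewrite /signed_sum -sumrN; apply: eq_bigr => i _; rewrite ffunE signrN mulNr.
Qed.

Lemma rad_sum_lipschitz (R : realType) (X : Type) (x0 : X) (N : nat)
    (L : R) (h : R -> R) (A : X -> 'I_N -> R) : 0 <= L ->
  (forall a b, `|h a - h b| <= L * `|a - b|) ->
  (rad_sum (fun x i => h (A x i)) <= L%:E * rad_sum A)%E.
Proof.
move=> L0 hL; apply: le_trans (rad_sumZ x0 A L0); apply: rad_sum_le => x y i.
by rewrite -mulrBr normrM (ger0_norm L0).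
Qed.

Lemma rad_sum_binop (R : realType) (X : Type) (x0 : X) (N : nat) (o : binop)
    (A B : X -> 'I_N -> R) :
  (rad_sum (fun x i => binop_fun o (A x i) (B x i)) <= rad_sum A + rad_sum B)%E.
Proof.
pose S (c : R) x i := 2^-1 * A x i + c * B x i.
(* With c = 1/2 and c = -1/2, [S c] is the half-sum and the half-difference of [A] and [B]. Each
   costs half of both averages, so together they cost exactly [rad_sum A + rad_sum B], with no extra
   factor. *)
have half2 (C : X -> 'I_N -> R) :
    ((2^-1)%:E * rad_sum C + (2^-1)%:E * rad_sum C = rad_sum C)%E.
  rewrite -ge0_muleDl ?lee_fin ?invr_ge0// -EFinD.
  by rewrite (_ : 2^-1 + 2^-1 = 1 :> R) ?mul1e//; lra.
have half0 : 0 <= 2^-1 :> R by rewrite invr_ge0.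
have halves : (rad_sum (S (2^-1)%R) + rad_sum (S (- 2^-1)%R) <= rad_sum A + rad_sum B)%E.
  rewrite -(half2 A) -(half2 B) addeACA.
  apply: leeD; apply: le_trans (rad_sumD _ _) _.
    by apply: leeD; exact: rad_sumZ.
  apply: leeD; first exact: rad_sumZ.
  apply: le_trans (rad_sumZ x0 B half0).
  by apply: rad_sum_le => x y i; rewrite -!mulrBr !normrM normrN.
(* max and min are (a + b)/2 plus or minus |a - b|/2 *)
have split (D : X -> 'I_N -> R) :
    (forall x y i, `|D x i - D y i| <= `|S (- 2^-1)%R x i - S (- 2^-1)%R y i|) ->
    (rad_sum (fun x i => S (2^-1)%R x i + D x i)%R <= rad_sum A + rad_sum B)%E.
  move=> hD; apply: le_trans (rad_sumD _ _) (le_trans _ halves).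
  by rewrite leeD2l// rad_sum_le.
case: o => /=.
- have -> : (fun x i => Num.max (A x i) (B x i)) =
      fun x i => S (2^-1)%R x i + `|S (- 2^-1)%R x i|.
    apply/funext => x; apply/funext => i; rewrite /S.
    case: (lerP (B x i) (A x i)) => h.
      by rewrite ger0_norm; lra.
    by rewrite ltr0_norm; lra.
  by apply: split => x y i; exact: ler_dist_dist.
- have -> : (fun x i => Num.min (A x i) (B x i)) =
      fun x i => S (2^-1)%R x i + (- `|S (- 2^-1)%R x i|).
    apply/funext => x; apply/funext => i; rewrite /S.
    case: (lerP (A x i) (B x i)) => h.
      by rewrite ler0_norm; lra.
    by rewrite gtr0_norm; lra.
  by apply: split => x y i; rewrite -opprD normrN; exact: ler_dist_dist.
- exact: rad_sumD.
- by apply: le_trans (rad_sumD _ _) _; rewrite leeD2l// rad_sumN.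
Qed.

(** * Euclidean norm, Cauchy-Schwarz and orthogonality of the signs *)

Lemma cauchy_schwarz (R : realType) (I : finType) (a b : I -> R) :
  (\sum_i a i * b i) ^+ 2 <= (\sum_i a i ^+ 2) * (\sum_i b i ^+ 2).
Proof.
have prodE (u v : I -> R) : (\sum_i u i) * (\sum_j v j) = \sum_i \sum_j u i * v j.
  by rewrite mulr_suml; apply: eq_bigr => i _; rewrite mulr_sumr.
(* Lagrange's identity: this double sum is twice the gap between the two sides. *)
have : 0 <= \sum_i \sum_j (a i * b j - a j * b i) ^+ 2.
  by apply: sumr_ge0 => i _; apply: sumr_ge0 => j _; rewrite sqr_ge0.
under eq_bigr do under eq_bigr do rewrite sqrrB !exprMn.
under eq_bigr do rewrite big_split sumrB /=.
rewrite big_split sumrB /= [X in _ + X]exchange_big /= -prodE.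
suff -> : \sum_i \sum_j a i * b j * (a j * b i) *+ 2 = (\sum_i a i * b i) ^+ 2 *+ 2.
  by rewrite mulr2n; lra.
rewrite expr2 prodE -sumrMnl; apply: eq_bigr => i _.
by rewrite -sumrMnl; apply: eq_bigr => j _; rewrite mulrACA [b j * _]mulrC mulrACA.
Qed.

Lemma sqr_enorm (R : realType) (n : nat) (u : 'cV[R]_n) :
  enorm u ^+ 2 = \sum_i u i 0 ^+ 2.
Proof. by rewrite sqr_sqrtr// sumr_ge0// => i _; rewrite sqr_ge0. Qed.

Lemma enorm_ge0 (R : realType) (n : nat) (u : 'cV[R]_n) : 0 <= enorm u.
Proof. exact: sqrtr_ge0. Qed.

Lemma dotmx_le_enorm (R : realType) (n : nat) (u v : 'cV[R]_n) :
  (u^T *m v) 0 0 <= enorm u * enorm v.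
Proof.
rewrite (le_trans (ler_norm _))// -(ler_pXn2r (n := 2))// ?nnegrE ?mulr_ge0 ?enorm_ge0//.
rewrite real_normK ?num_real// exprMn !sqr_enorm mxE.
under eq_bigr do rewrite mxE.
exact: cauchy_schwarz.
Qed.

Lemma sum_signed_sum_sqr (R : realType) (N : nat) (a : 'I_N -> R) :
  \sum_(eps : {ffun 'I_N -> bool}) signed_sum eps a ^+ 2 =
  2 ^+ N * \sum_i a i ^+ 2.
Proof.
have corr i j : \sum_(e : {ffun 'I_N -> bool}) (-1) ^+ e i * (-1) ^+ e j =
    (if j == i then 2 ^+ N else 0) :> R.
  case: eqVneq => [->|ji].
    under eq_bigr do rewrite -expr2 sqrr_sign.
    by rewrite sumr_const cardT -cardE card_ffun card_bool card_ord natrX.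
  (* Flipping the sign at [i] alone negates the product of two distinct signs, so the off-diagonal
     terms cancel in pairs. *)
  rewrite (sum_flip i) big1// => e ei.
  by rewrite !ffunE eqxx (negbTE ji) signrN mulNr addrN.
pose F e i j : R := (a i * a j) * ((-1) ^+ (e : {ffun 'I_N -> bool}) i * (-1) ^+ e j).
rewrite (eq_bigr (fun e => \sum_i \sum_j F e i j)); last first.
  move=> e _; rewrite expr2 mulr_suml; apply: eq_bigr => i _.
  by rewrite mulr_sumr; apply: eq_bigr => j _; rewrite mulrACA mulrC.
rewrite exchange_big mulr_sumr /=; apply: eq_bigr => i _.
rewrite exchange_big /= (bigD1 i)//= [X in _ + X]big1 => [|j ji].
  by rewrite -mulr_sumr corr eqxx addr0 mulrC.
by rewrite -mulr_sumr corr (negbTE ji) mulr0.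
Qed.

(** The mean of the norm is at most the root of its mean square, and the mean square is computed
    coordinate by coordinate from the orthogonality of the signs. *)
Lemma sum_enorm_signs (R : realType) (N n : nat) (v : 'I_N -> 'cV[R]_n) :
  \sum_(eps : {ffun 'I_N -> bool}) enorm (\sum_i (-1) ^+ eps i *: v i) <=
  2 ^+ N * Num.sqrt (\sum_i enorm (v i) ^+ 2).
Proof.
set V := fun eps : {ffun 'I_N -> bool} => \sum_i (-1) ^+ eps i *: v i.
have V2 : \sum_eps enorm (V eps) ^+ 2 = 2 ^+ N * \sum_i enorm (v i) ^+ 2.
  under eq_bigr do rewrite sqr_enorm.
  under [in RHS]eq_bigr do rewrite sqr_enorm.
  rewrite exchange_big /= [in RHS]exchange_big mulr_sumr /=.
  apply: eq_bigr => k _; rewrite -sum_signed_sum_sqr; apply: eq_bigr => e _.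
  by rewrite summxE; congr (_ ^+ 2); apply: eq_bigr => i _; rewrite mxE.
have s0 : 0 <= \sum_i enorm (v i) ^+ 2 by apply: sumr_ge0 => i _; exact: sqr_ge0.
rewrite -(ler_pXn2r (n := 2))// ?nnegrE; last 2 first.
- by apply: sumr_ge0 => e _; exact: enorm_ge0.
- by rewrite mulr_ge0 ?exprn_ge0 ?sqrtr_ge0.
rewrite exprMn sqr_sqrtr//.
(* Cauchy-Schwarz against the constant 1 over the [2 ^ N] patterns; this is the Jensen step. *)
have := cauchy_schwarz (fun e => enorm (V e)) (fun=> 1).
under eq_bigr do rewrite mulr1.
move=> /le_trans; apply; rewrite V2 expr1n.
rewrite sumr_const cardT -cardE card_ffun card_bool card_ord natrX.
by rewrite mulrAC -expr2.
Qed.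

(** * Sign averages of the affine components *)

Lemma sup_enorm_ge0 (R : realType) (T : Type) (t0 : T) (n : nat)
    (u : T -> 'cV[R]_n) : (0 <= sup_enorm u)%E.
Proof.
apply: (@le_trans _ _ (enorm (u t0))%:E); first by rewrite lee_fin enorm_ge0.
by apply: ereal_sup_ubound; exists t0.
Qed.

(** By linearity the signed sum is the inner product of [phi x] with one signed sum of vectors free
    of x. Cauchy-Schwarz then separates the supremum over x from the signs. *)
Lemma rad_sum_affine (R : realType) (X : Type) (x0 : X) (N n : nat)
    (v : 'I_N -> 'cV[R]_n) (c : 'I_N -> R) (phi : X -> 'cV[R]_n) :
  (rad_sum (fun x i => (((v i)^T *m phi x) 0 0 + c i)%R) <=
   (2 ^+ N * Num.sqrt (\sum_i enorm (v i) ^+ 2))%:E * sup_enorm phi)%E.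
Proof.
apply: le_trans (rad_sumD _ _) _; rewrite rad_sum_cst// adde0.
have L0 := sup_enorm_ge0 x0 phi.
apply: (@le_trans _ _ (\sum_(e : {ffun 'I_N -> bool})
    (enorm (\sum_i (-1) ^+ e i *: v i))%:E * sup_enorm phi)%E).
  apply: lee_sum => e _; apply: ge_ereal_sup => _ [x _ <-].
  apply: (@le_trans _ _ ((enorm (\sum_i (-1) ^+ e i *: v i))%:E * (enorm (phi x))%:E)%E).
    rewrite -EFinM lee_fin; apply: le_trans (dotmx_le_enorm _ _).
    rewrite linear_sum mulmx_suml summxE le_eqVlt; apply/orP; left; apply/eqP.
    by apply: eq_bigr => i _; rewrite linearZ -scalemxAl [RHS]mxE.
  by rewrite lee_wpmul2l ?lee_fin ?enorm_ge0//; apply: ereal_sup_ubound; exists x.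
rewrite -ge0_sume_distrl => [|e _]; last by rewrite lee_fin enorm_ge0.
by rewrite sumEFin lee_wpmul2r// lee_fin sum_enorm_signs.
Qed.

Lemma sqrt_sum_enorm (R : realType) (T : Type) (N n : nat)
    (u : T -> 'cV[R]_n) (t : 'I_N -> T) : (0 < N)%N ->
  ((Num.sqrt (\sum_i enorm (u (t i)) ^+ 2))%:E <=
   (Num.sqrt (N%:R : R))%:E * sup_enorm u)%E.
Proof.
move=> N0; have ub i : ((enorm (u (t i)))%:E <= sup_enorm u)%E.
  by apply: ereal_sup_ubound; exists (t i).
have sN0 : 0 < Num.sqrt (N%:R : R) by rewrite sqrtr_gt0 ltr0n.
(* A sample point exists because [N] is positive, which rules out a supremum equal to [-oo]. The
   value [+oo] is harmless since its factor is strictly positive. *)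
have := ub (Ordinal N0); case: (sup_enorm u) ub => [s| |] ub ubO //; last first.
  by rewrite gt0_muley ?lte_fin// leey.
have s0 : 0 <= s by move: ubO; rewrite lee_fin; apply: le_trans; exact: enorm_ge0.
rewrite -EFinM lee_fin -(ler_pXn2r (n := 2))// ?nnegrE ?mulr_ge0 ?sqrtr_ge0//.
rewrite exprMn !sqr_sqrtr ?ler0n//; last by apply: sumr_ge0 => i _; exact: sqr_ge0.
apply: (@le_trans _ _ (\sum_(i < N) s ^+ 2)).
  apply: ler_sum => i _; rewrite ler_pXn2r ?nnegrE ?enorm_ge0//.
  by have := ub i; rewrite lee_fin.
by rewrite sumr_const card_ord mulr_natl.
Qed.

Lemma rad_sum_component (R : realType) (X Theta : Type) (x0 : X) (n : nat -> nat)
    (psi : forall k, Theta -> 'cV[R]_(n k)) (phi : forall k, X -> 'cV[R]_(n k))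
    (eta : nat -> Theta -> R) (N : nat) (t : 'I_N -> Theta) (k : nat) :
  (0 < N)%N ->
  (rad_sum (fun x i => component psi phi eta k x (t i)) <=
   (2 ^+ N * Num.sqrt (N%:R : R))%R%:E * (sup_enorm (psi k) * sup_enorm (phi k)))%E.
Proof.
move=> N0; have L0 := sup_enorm_ge0 x0 (phi k).
apply: (le_trans (rad_sum_affine x0 (fun i => psi k (t i)) _ _)).
rewrite !EFinM -!muleA lee_wpmul2l ?lee_fin ?exprn_ge0// muleA lee_wpmul2r//.
exact: sqrt_sum_enorm.
Qed.

(** * Lipschitz constants and peeling of the composition *)

Lemma lip_constP (R : realType) (f : R -> R) : lipschitz f ->
  forall a b, `|f a - f b| <= lip_const f * `|a - b|.
Proof.
move=> /pinfty_ex_gt0 [M M0 fM] a b; have [->|ab] := eqVneq a b.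
  by rewrite !subrr normr0 mulr0.
(* Every admissible constant dominates the slope between [a] and [b], hence so does the infimum,
   which is therefore itself admissible. *)
have ab0 : 0 < `|a - b| by rewrite normr_gt0 subr_eq0.
rewrite -ler_pdivrMr//; apply: lb_le_inf; first by exists M.
by move=> L /= fL; rewrite ler_pdivrMr//; exact: (fL (a, b)).
Qed.

Lemma lip_const_ge0 (R : realType) (f : R -> R) :
  lipschitz f -> 0 <= lip_const f.
Proof.
move=> /lip_constP/(_ 1 0); rewrite subr0 normr1 mulr1.
exact: le_trans.
Qed.

Lemma rho_bar_prod_ge0 (R : realType) (varphi rho : nat -> R -> R) (C k : nat) :
  (forall k, (1 <= k <= C)%N -> lipschitz (varphi k)) ->
  (forall k, (2 <= k <= C)%N -> lipschitz (rho k)) ->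
  (1 <= k <= C)%N ->
  0 <= \prod_(k <= j < C.+1) rho_bar rho j * lip_const (varphi k).
Proof.
move=> Lphi Lrho kC; apply: mulr_ge0; last by apply/lip_const_ge0/Lphi.
rewrite big_nat_cond; apply: prodr_ge0 => j; rewrite andbT => /andP[kj jC].
rewrite /rho_bar; case: eqVneq => // j1; apply/lip_const_ge0/Lrho.
move: jC; rewrite ltnS => ->; rewrite andbT ltn_neqAle eq_sym j1 /=.
by case/andP: kC => + _; move=> /leq_trans; apply.
Qed.

(** Induction on the number of components: the outermost [rho] scales the whole bound, and the
    binary operator then splits it into the previous composition and one new term. The bounds [T k]
    may be [+oo]; their nonnegativity allows distributivity. *)
Lemma rad_sum_compose (R : realType) (X Theta : Type) (x0 : X)
    (varphi rho : nat -> R -> R) (g : nat -> binop)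
    (fc : nat -> X -> Theta -> R) (N : nat) (t : 'I_N -> Theta)
    (T : nat -> \bar R) (C : nat) :
  (forall k, (1 <= k <= C)%N -> lipschitz (varphi k)) ->
  (forall k, (2 <= k <= C)%N -> lipschitz (rho k)) ->
  (forall k, (0 <= T k)%E) ->
  (forall k, (1 <= k <= C)%N -> (rad_sum (fun x i => fc k x (t i)) <= T k)%E) ->
  (1 <= C)%N ->
  (rad_sum (fun x i => compose varphi rho g fc C x (t i)) <=
   \sum_(1 <= k < C.+1)
     (\prod_(k <= j < C.+1) rho_bar rho j * lip_const (varphi k))%R%:E * T k)%E.
Proof.
(* The induction starts at one component, where [rho_bar] is 1 and only [varphi] acts. *)
move=> + + T0 + C1; case: C C1 => // C _; elim: C => [|C IHC] Lphi Lrho fcT.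
  rewrite big_nat1 big_nat1 /rho_bar eqxx mul1r /=.
  have L1 := Lphi 1%N isT; have c0 := lip_const_ge0 L1.
  apply: le_trans (rad_sum_lipschitz x0 _ c0 (lip_constP L1)) _.
  by rewrite lee_wpmul2l ?lee_fin// fcT.
have Cle k m : (m <= k <= C.+1)%N -> (m <= k <= C.+2)%N.
  by move=> /andP[-> /leq_trans -> //].
have Lr : lipschitz (rho C.+2) by apply: Lrho; rewrite leqnn.
have Lp : lipschitz (varphi C.+2) by apply: Lphi; rewrite leqnn.
have r0 := lip_const_ge0 Lr; have p0 := lip_const_ge0 Lp.
have rhoE : rho_bar rho C.+2 = lip_const (rho C.+2) by [].
have coef0 k : (1 <= k <= C.+1)%N ->
    0 <= \prod_(k <= j < C.+2) rho_bar rho j * lip_const (varphi k).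
  by apply: rho_bar_prod_ge0 => j /Cle; [exact: Lphi|exact: Lrho].
apply: le_trans (rad_sum_lipschitz x0 _ r0 (lip_constP Lr)) _.
rewrite big_nat_recr//= big_nat1 rhoE EFinM -muleA.
(* The constant of the last [rho] occurs in every product, so it factors out of the whole sum. *)
rewrite (eq_big_nat _ _ (F2 := fun k => ((lip_const (rho C.+2))%:E *
    ((\prod_(k <= j < C.+2) rho_bar rho j * lip_const (varphi k))%R%:E * T k))%E));
    last first.
  move=> k /andP[_ kC].
  by rewrite big_nat_recr ?(ltnW kC)//= muleA -EFinM mulrCA mulrA.
have Tge0 k : (1 <= k <= C.+1)%N ->
    (0 <= (\prod_(k <= j < C.+2) rho_bar rho j * lip_const (varphi k))%R%:E * T k)%E.
  by move=> kC; rewrite mule_ge0 ?lee_fin ?coef0.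
rewrite big_nat_cond -ge0_sume_distrr; last first.
  by move=> k; rewrite andbT => /andP[? ?]; apply: Tge0; apply/andP.
rewrite -big_nat_cond -ge0_muleDr; last 2 first.
- rewrite big_nat_cond; apply: sume_ge0 => k; rewrite andbT => /andP[? ?].
  by apply: Tge0; apply/andP.
- by rewrite mule_ge0 ?lee_fin.
rewrite lee_wpmul2l ?lee_fin//.
apply: le_trans (rad_sum_binop x0 _ _ _) _; apply: leeD.
  apply: IHC => k /Cle; [exact: Lphi|exact: Lrho|exact: fcT].
apply: le_trans (rad_sum_lipschitz x0 _ p0 (lip_constP Lp)) _.
by rewrite lee_wpmul2l ?lee_fin// fcT// leqnn.
Qed.

(** * From the probability space to the average over sign patterns *)

(* No measurability is assumed, unlike in the library's ge0_le_integral: both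
   parts of the integral are suprema over simple functions. *)
Lemma le_integral_setT (d : measure_display) (T : measurableType d)
    (R : realType) (mu : {measure set T -> \bar R}) (f g : T -> \bar R) :
  (forall x, f x <= g x)%E -> (\int[mu]_x f x <= \int[mu]_x g x)%E.
Proof.
move=> fg; have mono (u v : T -> \bar R) : (forall x, 0 <= u x)%E ->
    (forall x, u x <= v x)%E -> (\int[mu]_x u x <= \int[mu]_x v x)%E.
  move=> u0 uv; have v0 x : (0 <= v x)%E by exact: le_trans (uv x).
  rewrite !ge0_integralTE//; apply: ereal_sup_le => _ [h hu <-].
  by exists h => // x; exact: le_trans (uv x).
rewrite [leLHS]integralE [leRHS]integralE; have fgT : {in setT, forall x, f x <= g x}%E by [].
apply: leeB; apply: mono => x; rewrite ?funepos_ge0 ?funeneg_ge0//.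
- by apply: (funepos_le fgT); rewrite inE.
- by apply: (funeneg_le fgT); rewrite inE.
Qed.

Lemma probability_signs (R : realType) (d d' : measure_display)
    (Omega : measurableType d) (Theta : measurableType d')
    (P : probability Omega R) (N : nat)
    (theta : {RV P >-> Theta}) (thetas : 'I_N -> {RV P >-> Theta})
    (sigma : 'I_N -> {RV P >-> R}) (eps : {ffun 'I_N -> bool}) :
  sample_and_signs theta thetas sigma ->
  P (\bigcap_(i in [set: 'I_N]) sigma i @^-1` [set (-1) ^+ eps i]) =
  ((2^-1) ^+ N)%:E.
Proof.
move=> [_ radS indep].
(* Independence is applied to the sign variables only; the value of [A] at sample indices is a
   filler. *)
pose J := [set inr i | i : 'I_N]%SET : {set 'I_N + 'I_N}.
pose A (j : 'I_N + 'I_N) : set Omega :=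
  if j is inr i then sigma i @^-1` [set (-1) ^+ eps i] else setT.
have inJ i : inr i \in J by apply/imsetP; exists i.
have := indep J A; rewrite (_ : \bigcap_(j in _) _ =
    \bigcap_(i in [set: 'I_N]) sigma i @^-1` [set (-1) ^+ eps i]); last first.
  apply/seteqP; split=> w Aw; first by move=> i _; exact: (Aw (inr i) (inJ i)).
  by move=> [i|i] //= _; exact: Aw.
move=> ->; last first.
  move=> _ /imsetP[i _ ->] /=; exists [set (-1) ^+ eps i] => //.
  by rewrite setTI.
rewrite big_imset /=; last by move=> i j _ _ [].
rewrite (eq_bigr (fun=> (2^-1)%:E)) => [|i _]; last first.
  by have [P1 PN1] := radS i; case: (eps i); rewrite ?expr1 ?expr0.
by rewrite prodEFin prodr_const card_ord.
Qed.

(** Almost surely the signs form one of the [2 ^ N] patterns, all equally likely, so the integrand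
    agrees almost everywhere with a simple function. [F] is arbitrary, so the integrand is only
    dominated by a measurable function. *)
Lemma integral_signs (R : realType) (d d' : measure_display)
    (Omega : measurableType d) (Theta : measurableType d')
    (P : probability Omega R) (N : nat)
    (theta : {RV P >-> Theta}) (thetas : 'I_N -> {RV P >-> Theta})
    (sigma : 'I_N -> {RV P >-> R}) (F : ('I_N -> R) -> \bar R) :
  sample_and_signs theta thetas sigma ->
  (forall s, -oo < F s)%E ->
  (\int[P]_w F (fun i => sigma i w) <= ((2^-1) ^+ N)%R%:E *
     \sum_(eps : {ffun 'I_N -> bool}) F (fun i => (-1) ^+ eps i)%R)%E.
Proof.
move=> smp FNy; set Fe := fun eps : {ffun 'I_N -> bool} => F (fun i => (-1) ^+ eps i).
(* If some pattern gives [+oo], the right-hand side is [+oo]; otherwise all pattern values are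
   finite reals. *)
have [[e Fey]|Fe_fin] := pselect (exists e, Fe e = +oo%E).
  rewrite (_ : \sum_eps _ = +oo)%E; last first.
    by apply/esum_eqyP => [i _|]; [rewrite gt_eqF|exists e; rewrite mem_index_enum].
  by rewrite gt0_muley ?leey// lte_fin exprn_gt0// invr_gt0.
pose f eps := fine (Fe eps).
have FeE eps : Fe eps = (f eps)%:E.
  rewrite fineK// fin_numE gt_eqF ?FNy//=; apply/eqP => Fey.
  by apply: Fe_fin; exists eps.
pose E (eps : {ffun 'I_N -> bool}) :=
  \bigcap_(i in [set: 'I_N]) sigma i @^-1` [set (-1) ^+ eps i].
have mE eps : measurable (E eps) by exact: fin_bigcap_measurable.
have PE eps : P (E eps) = ((2^-1) ^+ N)%:E by exact: probability_signs smp.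
have inE eps eps' w : E eps w -> E eps' w -> eps = eps'.
  move=> h h'; apply/ffunP => i; have /= := h i I; have /= := h' i I => ->.
  by case: (eps i) (eps' i) => -[] //=; rewrite ?expr1 ?expr0; lra.
pose g w : \bar R := (\sum_eps (f eps * \1_(E eps) w)%:E)%E.
have gE eps w : E eps w -> g w = (f eps)%:E.
  move=> Ew; rewrite /g (bigD1 eps)//= indicE mem_set// mulr1 big1 ?adde0//.
  move=> e ee; rewrite indicE memNset ?mulr0// => Ew'.
  by rewrite (inE _ _ _ Ew Ew') eqxx in ee.
pose U := \bigcup_(eps in [set: {ffun 'I_N -> bool}]) E eps.
have mU : measurable U by apply: fin_bigcup_measurable.
(* The cells [E eps] are disjoint and [2 ^ N] in number, each of mass [2^-1 ^+ N]. *)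
have PU : P U = 1%E.
  rewrite measure_fin_bigcup//; first last.
  - by move=> e e' _ _ [w [Ew Ew']]; exact: inE Ew Ew'.
  - exact: finite_finset.
  transitivity (\sum_(e : {ffun 'I_N -> bool}) P (E e))%E.
    rewrite [RHS]bigfs ?index_enum_uniq//; last by move=> e _; rewrite mem_index_enum.
    by apply: eq_fsbigl; apply/seteqP; split.
  rewrite (eq_bigr (fun=> ((2^-1) ^+ N)%:E)) => [|e _]; last exact: PE.
  rewrite sumEFin.
  rewrite sumr_const cardT -cardE card_ffun card_bool card_ord -[_ *+ (2 ^ N)]mulr_natr natrX.
  by rewrite -exprMn mulVf ?expr1n// pnatr_eq0.
have PUC : P (~` U) = 0%E by rewrite probability_setC// PU subee.
have intfE eps : P.-integrable setT (fun w => (f eps * \1_(E eps) w)%:E).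
  exact: integrableZl (integrable_indic P (mE eps)).
have mg : measurable_fun setT g.
  by apply: emeasurable_sum => eps; exact: measurable_int (intfE eps).
(* F is uncontrolled on the null event where some sign is not -1 or 1. *)
pose G w : \bar R := if w \in U then g w else +oo%E.
have mG : measurable_fun setT G.
  apply: measurable_fun_ifT => //.
  by apply: (measurable_fun_bool true); rewrite setTI preimage_mem_true.
apply: (@le_trans _ _ (\int[P]_w G w)%E).
  apply: le_integral_setT => w; rewrite /G.
  case: ifPn => [|_]; last by rewrite leey.
  rewrite in_setE => -[eps _ Ew]; rewrite (gE eps)// -FeE /Fe.
  rewrite (_ : (fun i => sigma i w) = (fun i => (-1) ^+ eps i))//.
  by apply/funext => i; exact: (Ew i I).
have -> : (\int[P]_w G w = \int[P]_w g w)%E.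
  apply: ae_eq_integral => //; exists (~` U); split=> //; first exact: measurableC.
  by move=> w /=; apply: contra_not => Uw _; rewrite /G mem_set.
rewrite integral_sum// fin_num_sume_distrr//; last first.
  by move=> e e' _ _; rewrite -!/(Fe _) !FeE.
rewrite le_eqVlt; apply/orP; left; apply/eqP; apply: eq_bigr => e _.
rewrite -/(Fe _) FeE -(PE e) muleC -[in RHS](setIT (E e)) -integral_indic//.
by rewrite -integralZl//; exact: integrable_indic.
Qed.

(** * The empirical complexity and the final bound *)

Lemma emp_rademacher_le (R : realType) (d d' : measure_display)
    (Omega : measurableType d) (Theta : measurableType d')
    (P : probability Omega R) (N : nat)
    (theta : {RV P >-> Theta}) (thetas : 'I_N -> {RV P >-> Theta})
    (sigma : 'I_N -> {RV P >-> R}) (X : Type) (x0 : X) (h : X -> Theta -> R)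
    (t : 'I_N -> Theta) :
  sample_and_signs theta thetas sigma ->
  (emp_rademacher sigma [set h x | x in [set: X]] t <=
   (2^-1 ^+ N * (N%:R)^-1)%R%:E * rad_sum (fun x i => h x (t i)))%E.
Proof.
move=> smp.
pose F (s : 'I_N -> R) : \bar R := ereal_sup
  [set ((N%:R)^-1 * \sum_(i < N) s i * h x (t i))%:E | x in [set: X]].
rewrite /emp_rademacher.
rewrite (_ : (fun w => _) = fun w => F (fun i => sigma i w)); last first.
  by apply/funext => w; rewrite image_comp.
apply: le_trans (integral_signs smp _) _ => [s|].
  exact: ereal_sup_fin_gtNy.
rewrite EFinM -muleA lee_wpmul2l ?lee_fin ?exprn_ge0 ?invr_ge0//.
apply: le_trans (rad_sumZ x0 _ _); last by rewrite invr_ge0.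
apply: lee_sum => e _; apply: ge_ereal_sup => _ [x _ <-].
by apply: ereal_sup_ubound; exists x; rewrite // signed_sumZ.
Qed.

Unset Implicit Arguments.

Theorem theorem2 (R : realType)
    (d d' : measure_display) (Omega : measurableType d)
    (Theta : measurableType d') (P : probability Omega R) (X : Type)
    (N : nat) (hN : (0 < N)%N)
    (theta : {RV P >-> Theta}) (thetas : 'I_N -> {RV P >-> Theta})
    (sigma : 'I_N -> {RV P >-> R})
    (hsample : sample_and_signs theta thetas sigma)
    (C : nat) (hC : (1 <= C)%N) (n : nat -> nat)
    (psi : forall k, Theta -> 'cV[R]_(n k))
    (phi : forall k, X -> 'cV[R]_(n k))
    (eta : nat -> Theta -> R)
    (varphi rho : nat -> R -> R) (g : nat -> binop)
    (hvarphi : forall k, (1 <= k <= C)%N -> lipschitz (varphi k))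
    (hrho : forall k, (2 <= k <= C)%N -> lipschitz (rho k)) :
  (rademacher thetas sigma
     [set compose varphi rho g (component psi phi eta) C x | x in [set: X]] <=
   \sum_(1 <= k < C.+1)
     ((\prod_(k <= j < C.+1) rho_bar rho j * lip_const (varphi k))%R%:E
      * sup_enorm (psi k) * sup_enorm (phi k)) / (Num.sqrt (N%:R : R))%:E)%E.
Proof.
set h := compose _ _ _ _ _.
set M := (leRHS).
have integral_cstP (r : \bar R) : (\int[P]_(w in setT) r = r)%E.
  rewrite -[LHS]/(\int[P]_(w in setT) cst r w)%E integral_cst//.
  by have /= -> := probability_setT P; rewrite mule1.
(* For empty [X] the class is empty, its supremum is [-oo], and both integrals stay [-oo]. *)
have [[x0]|noX] := pselect (inhabited X); last first.
  rewrite /rademacher /emp_rademacher (_ : range h = set0).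
    under eq_integral do under eq_integral do rewrite image_set0 ereal_sup0.
    under eq_integral do rewrite integral_cstP.
    by rewrite integral_cstP leNye.
  by apply/seteqP; split=> // y [x _ _]; case: noX.
(* The bound is uniform in the sample, so it is compared pointwise with a constant of the same
   integral. *)
rewrite -(integral_cstP M); apply: le_integral_setT => w.
apply: le_trans (emp_rademacher_le x0 _ _ hsample) _.
pose t i := thetas i w; have [i0] : inhabited 'I_N by split; exact: Ordinal hN.
pose T k := (sup_enorm (psi k) * sup_enorm (phi k))%E.
have T0 k : (0 <= T k)%E.
  by rewrite mule_ge0// (sup_enorm_ge0 (t i0), sup_enorm_ge0 x0).
have s0 : 0 < Num.sqrt (N%:R : R) by rewrite sqrtr_gt0 ltr0n.
have K0 : 0 <= 2 ^+ N * Num.sqrt (N%:R : R) by rewrite mulr_ge0 ?exprn_ge0// ltW.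
have c0 : 0 <= 2^-1 ^+ N * (N%:R)^-1 :> R.
  by rewrite mulr_ge0 ?exprn_ge0 ?invr_ge0.
have KT0 k : (0 <= (2 ^+ N * Num.sqrt (N%:R : R))%R%:E * T k)%E.
  by rewrite mule_ge0 ?lee_fin.
have rad_h := rad_sum_compose x0 g (t := t) hvarphi hrho KT0
  (fun k _ => rad_sum_component x0 psi phi eta t k hN) hC.
apply: (le_trans (lee_wpmul2l _ rad_h)); first by rewrite lee_fin.
rewrite big_nat_cond ge0_sume_distrr => [|k]; last first.
  by rewrite andbT => /andP[? ?]; rewrite mule_ge0// lee_fin rho_bar_prod_ge0// -ltnS; apply/andP.
rewrite -big_nat_cond /M le_eqVlt; apply/orP; left; apply/eqP.
apply: eq_big_nat => k _; rewrite inver gt_eqF//.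
rewrite -[(_ * _ * sup_enorm (phi k))%E]muleA -/(T k).
(* [T k] may be infinite, so it is set aside and only real coefficients are compared: the powers of
   2 cancel and sqrt N / N equals 1 / sqrt N. *)
move: (T k) => Tk; rewrite muleAC -EFinM !muleA -!EFinM.
congr (_%:E * _)%E.
have N2 : N%:R = Num.sqrt (N%:R : R) ^+ 2 by rewrite sqr_sqrtr ?ler0n.
rewrite {1}N2 exprVn; field.
by rewrite gt_eqF// expf_neq0.
Qed.
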